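(* Let $G$ be an abelian group (written multiplicatively, with identity $1$), and let $A$ and $B$ be nonempty finite subsets of $G$ such that $|A| = |B|$ and $1 \notin B$. Then there exists a matching from $A$ to $B$ if and only if for every pair of nonempty subsets $S \subseteq A$ and $R \subseteq B \cup \{1\}$ such that $SR = S$, we have $|S| \leq |B \setminus R|$.
   Context: For subsets $X, Y$ of $G$, $XY = \{xy : x \in X, y \in Y\}$. A matching from $A$ to $B$ (where $A, B$ are finite subsets of $G$ with $|A|=|B|$) is a bijection $f : A \to B$ such that $a f(a) \notin A$ for all $a \in A$. *)

(* Defs.v *)
From mathcomp Require Import all_boot.
From mathcomp Require Import finmap.

Set Implicit Arguments.
Unset Strict Implicit.
Unset Printing Implicit Defensive.

Local Open Scope group_scope.
Local Open Scope fset_scope.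

Definition fsetmulg (G : groupType) (X Y : {fset G}) : {fset G} :=
  [fset x * y | x in X, y in Y].

(* [A] and [B] are coerced to the finite types of their elements. *)
Definition is_matching (G : groupType) (A B : {fset G}) (f : A -> B) : Prop :=
  bijective f /\ forall a : A, val a * val (f a) \notin A.

(* Main.v *)
(** Necessity: a matching sends [S] into [B `\` R].  Sufficiency: if Hall's
    condition fails at [S], let [R] consist of [1] and of all [b] in [B] with
    [S b] inside [A]; then [S R] lies in [A] and [|S| + |R| > |A| + 1].  Iterating
    the Dyson transform [(S, R) |-> (S U eR, R n e^-1 S)] with [e] in [S], which
    preserves [|S| + |R|], does not enlarge [S R] and keeps [1] in [R], one ends
    with [T] inside [S R] and [K] inside [R] such that [T K = T] and
    [|T| + |K| >= |S| + |R|]; the pair [(T, K)] violates the hypothesis. *)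

Require Import Defs.
From mathcomp Require Import all_boot finmap zify.

Set Implicit Arguments.
Unset Strict Implicit.
Unset Printing Implicit Defensive.

Local Open Scope group_scope.
Local Open Scope fset_scope.

Section Hall.

Variables T U : finType.
Implicit Types (N : T -> {set U}) (S : {set T}).

Definition nbr N S : {set U} := (\bigcup_(x in S) N x)%SET.

Definition hall N : Prop := forall S, #|S| <= #|nbr N S|.

Definition del N x b : T -> {set U} :=
  fun z => if z == x then (N x :\ b)%SET else N z.

Lemma nbr_del N x b S :
  nbr (del N x b) S =
    if x \in S then ((N x :\ b) :|: nbr N (S :\ x))%SET else nbr N S.
Proof.
rewrite /nbr; case: ifP => xS.
  rewrite (big_setD1 x) //= /del eqxx; congr (_ :|: _)%SET.
  by apply: eq_bigr => z; rewrite !inE => /andP[/negPf->].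
apply: eq_bigr => z zS; rewrite /del; case: eqP => // zx.
by rewrite -zx zS in xS.
Qed.

(* Rado: submodularity of the size of the neighbourhood excludes that both
   deletions break Hall's condition. *)
Lemma hall_del N x b c : hall N -> b \in N x -> c \in N x -> b != c ->
  hall (del N x b) \/ hall (del N x c).
Proof.
move=> hN bN cN bc.
have [/forallP|/forallPn[S1]] :=
  boolP [forall S : {set T}, #|S| <= #|nbr (del N x b) S|]; first by left.
have [/forallP|/forallPn[S2]] :=
  boolP [forall S : {set T}, #|S| <= #|nbr (del N x c) S|]; first by right.
(* A violating set that misses [x] keeps its neighbourhood and would violate [hall N], so both [S1]
   and [S2] contain [x]. *)
rewrite !nbr_del; case: ifP => xS2; last by rewrite hN.
case: ifP => xS1; last by rewrite hN.
move: (cardsD1 x S1) (cardsD1 x S2); rewrite xS1 xS2.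
set P := (S1 :\ x)%SET; set Q := (S2 :\ x)%SET => -> ->.
set X := (_ :|: nbr N Q)%SET; set Y := (_ :|: nbr N P)%SET => hX hY.
(* As [b != c], each neighbour of [x] survives one of the two deletions, so [X :|: Y] contains all
   of [N x]. *)
have hU : #|(x |: (P :|: Q))%SET| <= #|(X :|: Y)%SET|.
  apply: leq_trans (hN _) (subset_leq_card _).
  apply/subsetP => y /bigcupP[z]; rewrite !inE.
  case/or3P => [/eqP->|zP|zQ] yz.
  - by rewrite yz !andbT; case: (eqVneq y c) => // ->; rewrite eq_sym bc !orbT.
  - suff -> : y \in nbr N P by rewrite !orbT.
    by apply/bigcupP; exists z => //; rewrite !inE.
  - suff -> : y \in nbr N Q by rewrite !orbT.
    by apply/bigcupP; exists z => //; rewrite !inE.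
have hI : #|(P :&: Q)%SET| <= #|(X :&: Y)%SET|.
  apply: leq_trans (hN _) (subset_leq_card _).
  apply/subsetP => y /bigcupP[z]; rewrite inE => /andP[zP zQ] yz.
  rewrite inE; apply/andP.
  by split; rewrite inE; apply/orP; right; apply/bigcupP; exists z.
have xPQ : x \notin (P :|: Q)%SET by rewrite !inE eqxx.
(* Adding [hU] and [hI] gives [|X| + |Y| >= |P| + |Q| + 1], whereas the violations say [|X| <= |Q|]
   and [|Y| <= |P|]. *)
move: hU; rewrite cardsU1 xPQ.
have := cardsUI P Q; have := cardsUI X Y; lia.
Qed.

(** Induction on the number of edges: a vertex with two neighbours can lose one of these edges. Once
    all neighbourhoods are singletons, Hall's condition on pairs is injectivity. *)
Theorem hall_marriage N : hall N ->
  exists f : T -> U, injective f /\ forall x, f x \in N x.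
Proof.
have [n] := ubnP (\sum_x #|N x|); elim: n N => // n IHn N ltn hN.
have N1 x : 0 < #|N x| by have := hN [set x]%SET; rewrite cards1 /nbr big_set1.
have [/existsP[x /card_gt1P[b [c [bN cN bc]]]]|] :=
  boolP [exists x, 1 < #|N x|].
- have step d : d \in N x -> hall (del N x d) ->
      exists f : T -> U, injective f /\ forall x, f x \in N x.
    move=> dN hd; case: (IHn (del N x d)) => //.
      move: ltn; rewrite ltnS; apply: leq_trans.
      rewrite (bigD1 x) //= [X in _ <= X](bigD1 x) //= /del eqxx.
      rewrite [in X in _ <= X](cardsD1 d) dN -add1n -addnA leq_add2l leq_add2l.
      by apply: leq_sum => z /negPf->.
    move=> f [fI fN]; exists f; split=> // z.
    by have := fN z; rewrite /del; case: eqP => // ->; rewrite inE => /andP[].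
  by case: (hall_del hN bN cN bc) => /step; apply.
- rewrite negb_exists => /forallP N2.
  have /fin_all_exists[f fN] : forall x, exists y, N x = [set y]%SET.
    by move=> x; apply/cards1P; have := N1 x; have := N2 x; lia.
  exists f; split=> [x y fxy|x]; last by rewrite fN inE.
  apply/eqP; apply: contraTT isT => xy.
  have := hN [set x; y]%SET.
  by rewrite cards2 xy /nbr bigcup_setU !big_set1 !fN fxy setUid cards1.
Qed.

End Hall.

Section AbelianGroup.

Variable G : groupType.
Hypothesis hG : forall x y : G, x * y = y * x.
Implicit Types S R T : {fset G}.

Lemma fsetmulgP S R z :
  reflect (exists x y, [/\ x \in S, y \in R & z = x * y])
          (z \in fsetmulg S R).
Proof.
rewrite /fsetmulg; apply: (iffP (imfset2P _ _ _ _ _)) => /= [[x xS [y yR ->]]|[x [y [xS yR ->]]]].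
  by exists x, y.
by exists x => //; exists y.
Qed.

Lemma mem_fsetmulg S R x y : x \in S -> y \in R -> x * y \in fsetmulg S R.
Proof. by move=> xS yR; apply/fsetmulgP; exists x, y. Qed.

(** Closure gives one inclusion; a single translate of [S] already has [|S|] elements, which forces
    equality. *)
Lemma fsetmulg_eq S R : R != fset0 ->
  (forall x y, x \in S -> y \in R -> x * y \in S) -> fsetmulg S R = S.
Proof.
case/fset0Pn=> y yR clo; apply/eqP.
rewrite eqEfcard; apply/andP; split.
  by apply/fsubsetP => _ /fsetmulgP[x [z [xS zR ->]]]; apply: clo.
have <- : #|` [fset x * y | x in S]| = #|` S|.
  by rewrite card_imfset //; apply: mulIg.
apply: fsubset_leq_card; apply/fsubsetP => _ /imfsetP[x /= xS ->].
exact: mem_fsetmulg.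
Qed.

(** The trace on [R] of the stabilizer of [T] under translation; staying inside [R] is what later
    places it in [B] with [1] adjoined. *)
Definition stabilizing T R : {fset G} :=
  [fset r in R | fsetmulg T [fset r] == T].

Lemma fsetmulg_stabilizing T R :
  stabilizing T R != fset0 -> fsetmulg T (stabilizing T R) = T.
Proof.
move=> K0; apply: fsetmulg_eq => // x y xT.
rewrite !inE /= => /andP[_ /eqP <-].
by apply: mem_fsetmulg; rewrite ?inE.
Qed.

(** Induction on [|R|]. If [S R] lies in [S], take [T = S], stabilized by all of [R]; otherwise some
    [e * r] falls outside [S], and the Dyson transform at [e] drops [r] from [R]. *)
Lemma stabilized_subset S R : S != fset0 -> 1 \in R ->
  exists T, [/\ T != fset0, T `<=` fsetmulg S R, 1 \in stabilizing T R &
    #|` S| + #|` R| <= #|` T| + #|` stabilizing T R|].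
Proof.
have stab1 T R' : 1 \in R' -> 1 \in stabilizing T R'.
  move=> R1; rewrite !inE R1 /=; apply/eqP/fsetmulg_eq.
    by apply/fset0Pn; exists 1; rewrite inE.
  by move=> x y xT; rewrite inE => /eqP->; rewrite mulg1.
have [n] := ubnP #|` R|; elim: n S R => // n IHn S R ltR S0 R1.
have [SR|] := boolP (fsetmulg S R `<=` S).
  exists S; split=> //; last 2 [exact: stab1].
    by apply/fsubsetP => x xS; rewrite -[x]mulg1 mem_fsetmulg.
  rewrite leq_add2l fsubset_leq_card //; apply/fsubsetP => r rR.
  rewrite !inE rR /=; apply/eqP/fsetmulg_eq.
    by apply/fset0Pn; exists r; rewrite inE.
  move=> x y xS; rewrite inE => /eqP->.
  by apply: (fsubsetP SR); apply: mem_fsetmulg.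
case/fsubsetPn => _ /fsetmulgP[e [r [eS rR ->]]] erS.
pose eR := [fset e * x | x in R].
pose R' := [fset x in R | e * x \in S].
have R'R : R' `<=` R by apply/fsubsetP => x; rewrite !inE => /andP[].
have card_eR : #|` eR| = #|` R| by rewrite card_imfset //; apply: mulgI.
(* [S] meets [eR] exactly in [e R'], hence the transform preserves the sum of the two sizes. *)
have card_cap : #|` S `&` eR| = #|` R'|.
  have <- : #|` [fset e * x | x in R']| = #|` R'|.
    by rewrite card_imfset //; apply: mulgI.
  congr #|` _|.
  apply/fsetP => z; rewrite inE; apply/andP/imfsetP.
    case=> zS /imfsetP[x /= xR zE]; exists x => //.
    by rewrite !inE /= xR -zE.
  case=> x /=; rewrite !inE => /andP[xR exS] ->; split=> //.
  by apply/imfsetP; exists x.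
case: (IHn (S `|` eR) R').
- move: ltR; rewrite ltnS; apply: leq_trans; apply: fproper_ltn_card.
  rewrite fproperE R'R; apply/fsubsetPn; exists r => //.
  by rewrite !inE rR (negPf erS).
- by apply/fset0Pn; exists e; rewrite inE eS.
- by rewrite !inE R1 mulg1.
move=> T [T0 TS T1 cT]; exists T.
have KK : stabilizing T R' `<=` stabilizing T R.
  apply/fsubsetP => x; rewrite !inE /= => /andP[/andP[-> _] ->] //.
split=> //; last 2 [exact: (fsubsetP KK)].
- apply: fsubset_trans TS _; apply/fsubsetP => _ /fsetmulgP[x [y [xS yR' ->]]].
  move: yR'; rewrite !inE /= => /andP[yR eyS].
  move: xS; rewrite inE => /orP[xS|/imfsetP[w /= wR ->]].
    exact: mem_fsetmulg.
  (* Commutativity enters here: [e * w * y] is [(e * y) * w] with [e * y] in [S] and [w] in [R]. *)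
  by rewrite -mulgA [w * y]hG mulgA mem_fsetmulg.
- have := fsubset_leq_card KK; have := cardfsUI S eR; rewrite card_cap card_eR.
  by move: cT; lia.
Qed.

End AbelianGroup.

Theorem theorem2p1 (G : groupType) (hG : forall x y : G, x * y = y * x)
    (A B : {fset G}) (hA : A != fset0) (hB : B != fset0)
    (hAB : #|` A| = #|` B|) (h1 : 1 \notin B) :
  (exists f : A -> B, is_matching f) <->
  (forall S R : {fset G},
     S != fset0 -> R != fset0 ->
     S `<=` A -> R `<=` B `|` [fset 1] ->
     fsetmulg S R = S ->
     (#|` S| <= #|` B `\` R|)%N).
Proof.
split=> [[f [/bij_inj fI fN]] S R _ _ SA _ SR|H].
  pose g (x : S) : G := val (f (fincl SA x)).
  have gI : injective g.
    by move=> x y /val_inj /fI /(congr1 val) /= xy; apply: val_inj.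
  have -> : #|` S| = #|` [fset g x | x in {: S}]|.
    by rewrite card_imfset //= cardfE cardE.
  apply: fsubset_leq_card; apply/fsubsetP => _ /imfsetP[x _ ->].
  rewrite inE fsvalP andbT.
  (* If the partner of [x] were in [R], their product would lie in [S R = S], hence in [A]. *)
  apply: contra (fN (fincl SA x)) => gR; apply: (fsubsetP SA).
  by rewrite -[X in _ \in X]SR; apply: mem_fsetmulg => //; apply: fsvalP.
pose N (a : A) : {set B} := [set b : B | val a * val b \notin A]%SET.
suff /hall_marriage[f [fI fN]] : hall N.
  exists f; split; first by apply: inj_card_bij => //; rewrite -!cardfE hAB.
  by move=> a; have := fN a; rewrite inE.
move=> S0; rewrite leqNgt; apply/negP => ltN.
pose S : {fset G} := [fset val x | x in S0].
have cS : #|` S| = #|S0| by rewrite card_imfset /= ?cardE //; apply: val_inj.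
(* Non-neighbours of [S0] are the [b] in [B] with [S b] inside [A]. *)
pose V : {fset G} := [fset val b | b in ~: nbr N S0]%SET.
have cV : #|` V| = #|(~: nbr N S0)%SET|.
  by rewrite card_imfset /= ?cardE //; apply: val_inj.
have VB : V `<=` B by apply/fsubsetP => _ /imfsetP[b _ ->]; apply: fsvalP.
have S_neq0 : S != fset0 by rewrite -cardfs_gt0 cS; lia.
pose R : {fset G} := 1 |` V.
have cR : #|` R| = #|` V|.+1.
  by rewrite cardfsU1 (contra (fsubsetP VB 1)).
have SRA : fsetmulg S R `<=` A.
  apply/fsubsetP => _ /fsetmulgP[_ [y [/imfsetP[a /= aS ->] yR ->]]].
  move: yR; rewrite !inE => /orP[/eqP->|]; first by rewrite mulg1 fsvalP.
  case/imfsetP=> b /=; rewrite inE => bN ->.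
  apply: contraNT bN => abA; apply/bigcupP; exists a => //.
  by rewrite inE.
have [|T [T0 TSR K1 cT]] := @stabilized_subset G hG S R S_neq0.
  by rewrite !inE eqxx.
set K := stabilizing T R in K1 cT.
have K0 : K != fset0 by apply/fset0Pn; exists 1.
have KB : K `<=` B `|` [fset 1].
  apply/fsubsetP => x; rewrite !inE /= => /andP[/orP[->|/(fsubsetP VB)->]//].
  by rewrite orbT.
have := H T K T0 K0 (fsubset_trans TSR SRA) KB (fsetmulg_stabilizing K0).
(* The extra one is the element [1], which is in [K] but not in [B]. *)
have cBK : (#|` B `\` K| + #|` K|)%N = #|` B|.+1.
  have <- : #|` B `|` [fset 1]| = #|` B|.+1.
    by rewrite fsetUC cardfsU1 h1.
  have := cardfsID K (B `|` [fset 1]).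
  rewrite (fsetIidPr KB) fsetDUl.
  have /eqP-> : [fset 1] `\` K == fset0 by rewrite fsetD_eq0 fsub1set.
  by rewrite fsetU0; lia.
(* The hypothesis gives [|T| + |K| <= |B| + 1], but [|S| + |R| = |S0| + |B| - |nbr N S0| + 1] is at
   least [|B| + 2]. *)
have := cardsC (nbr N S0); rewrite -cardfE -hAB.
by move: cT ltN; rewrite cR cS cV; lia.
Qed.
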